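(* Let $X$ be an infinite set. If $S$ is a subsemigroup of $\mathrm{Surj}_X$ such that $\omega_S^r$ is finitely generated, then $S$ is countable. Thus, the universal right congruence on each of the following semigroups is not finitely generated: $\mathrm{Surj}_X$; $\mathrm{DBL}_{X,q}$ where $\aleph_0\leq q\leq|X|$; $\mathrm{DBL}_X^1$; $\mathrm{Sym}_X\cup \mathrm{DBL}_X$; and $\mathrm{Sym}_X$.
   Context: Maps are written on the right and composed from left to right. $\mathrm{Surj}_X$ is the monoid of all surjective maps $X\to X$, with identity $1_X$; $\mathrm{Sym}_X$ is the group of all bijections $X\to X$. For an infinite cardinal $q\leq|X|$, $\mathrm{DBL}_{X,q}=\{\alpha\in\mathrm{Surj}_X:|x\alpha^{-1}|=q\text{ for all }x\in X\}$; $\mathrm{DBL}_X=\mathrm{DBL}_{X,|X|}$ and $\mathrm{DBL}_X^1=\mathrm{DBL}_X\cup\{1_X\}$. A right congruence on a semigroup $S$ is an equivalence relation $\rho$ such that $(a,b)\in\rho$ implies $(as,bs)\in\rho$ for all $s\in S$. The universal right congruence $\omega_S^r$ is $S\times S$ viewed as a right congruence; it is finitely generated if there is a finite $U\subseteq S\times S$ such that $S\times S$ is the smallest right congruence on $S$ containing $U$. Countable means finite or countably infinite. *)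

(* Defs.v *)
From HB Require Import structures.
From mathcomp Require Import all_boot.
From mathcomp Require Import all_classical.

Set Implicit Arguments.
Unset Strict Implicit.
Unset Printing Implicit Defensive.

Local Open Scope classical_set_scope.
Local Open Scope card_scope.
Local Open Scope group_scope.

Section RightCongruences.
Variables (M : semigroupType) (S : set M).

Definition subsemigroup : Prop :=
  forall a b : M, S a -> S b -> S (a * b).

(* A right congruence on S is a set of pairs of elements of S; multipliers
   range over S only, not over the ambient semigroup M. *)
Definition right_congruence (rho : set (M * M)) : Prop :=
  [/\ rho `<=` S `*` S,
      forall a, S a -> rho (a, a),
      forall a b, rho (a, b) -> rho (b, a),
      forall a b c, rho (a, b) -> rho (b, c) -> rho (a, c) &
      forall a b s, rho (a, b) -> S s -> rho (a * s, b * s)].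

Definition universal_right_congruence : set (M * M) := S `*` S.

Definition universal_right_congruence_fg : Prop :=
  exists U : set (M * M),
    [/\ finite_set U, U `<=` S `*` S &
        universal_right_congruence = smallest right_congruence U].

End RightCongruences.

(* Maps X -> X written on the right, so that a * b is "first a, then b". *)
Definition transf (X : Type) : Type := X -> X.

Section Transformations.
Variable X : Type.

Definition transf_mul (a b : transf X) : transf X := fun x => b (a x).
Definition transf_one : transf X := fun x => x.

Lemma transf_mulA : associative transf_mul. Proof. by []. Qed.
Lemma transf_mul1 : left_id transf_one transf_mul. Proof. by []. Qed.
Lemma transf_mulr1 : right_id transf_one transf_mul. Proof. by []. Qed.

HB.instance Definition _ := gen_eqMixin (transf X).
HB.instance Definition _ := gen_choiceMixin (transf X).
HB.instance Definition _ :=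
  isMonoid.Build (transf X) transf_mulA transf_mul1 transf_mulr1.

Lemma transf_mulE (a b : transf X) (x : X) : (a * b) x = b (a x).
Proof. by []. Qed.

Definition Surj : set (transf X) :=
  [set a : transf X | set_surj [set: X] [set: X] a].

Definition Sym : set (transf X) :=
  [set a : transf X | set_bij [set: X] [set: X] a].

(* The cardinal q is given as the cardinality of a type Q. *)
Definition DBLq (Q : Type) : set (transf X) :=
  Surj `&` [set a : transf X | forall x : X, a @^-1` [set x] #= [set: Q]].

Definition DBL : set (transf X) := DBLq X.

Definition DBL1 : set (transf X) := DBL `|` [set 1].

End Transformations.

Arguments Surj X : clear implicits.
Arguments Sym X : clear implicits.
Arguments DBLq X Q : clear implicits.
Arguments DBL X : clear implicits.
Arguments DBL1 X : clear implicits.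

(* Main.v *)
Require Import Defs.
From HB Require Import structures.
From mathcomp Require Import all_boot.
From mathcomp Require Import all_classical.
From Stdlib Require Import Relation_Operators.

(** Surjections can be cancelled on the left: if [u] is onto and [u * s = u * t]
then [s = t], because the values of [s] and [t] are read off along [u].  Two
elements of [S] related by the right congruence generated by [U] are joined by
a finite chain of elementary transitions, each passing from [u * s] to [v * s]
with [(u, v)] or [(v, u)] in [U].  By cancellation the current element and the
pair [(u, v)] determine [s], hence the next element; so the elements reachable
from a fixed [a] are coded by finite words over the countable alphabet [U].
If [U] generates the universal right congruence then everything is reachable
from [a], and [S] is countable ([countable_connected], [countable_of_fg]).

The listed semigroups are refuted by size.  Splitting [X] into pairs
(a bijection of [X] with [X * bool]) and flipping the pairs indexed by a subset
of [X] embeds the power set of [X] into [Sym X], which is therefore uncountable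
by Cantor's theorem ([Sym_uncountable]).  Each semigroup [S] of the list
receives an injection from [Sym X]: an inclusion, or [p |-> a * p] with [a] a
fixed element of [DBLq X Q], injective by the same cancellation.

The existence of such an [a] (a projection [X * Q -> X] seen through a
bijection of [X] with [X * Q]), the closure of [DBLq X Q] under products and the
pairs used above all rest on the idempotence of infinite cardinals, |T x T| =
|T|, proved from Zorn's lemma ([card_square]). *)

Local Open Scope classical_set_scope.
Local Open Scope card_scope.

(** * Comparison of cardinals *)

Definition pointed_at {U : Type} (u : U) : pointedType :=
  HB.pack U (gen_eqMixin U) (gen_choiceMixin U) (isPointed.Build U u).

(** Subsets are compared through maps between subtypes; a default value [u]
turns such a map into one defined on the whole type. *)
Lemma card_leE {T U : Type} (u : U) (A : set T) (B : set U) : A #<= B ->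
  exists2 f : T -> U, set_fun A B f & forall x y, A x -> A y -> f x = f y -> x = y.
Proof.
move=> AB; have [f] := elimT (@pcard_leP T (pointed_at u) A B) AB.
exists f; first exact: funS.
by move=> x y Ax Ay; apply: inj; rewrite inE.
Qed.

(** Injections given by a relation: the choice of values, and the case of an
empty [A] with [U] possibly empty, are dealt with once and for all here. *)
Lemma card_le_rel {T U : Type} (R : T -> U -> Prop) (A : set T) (B : set U) :
  (forall x, A x -> exists2 y, B y & R x y) ->
  (forall x x' y, A x -> A x' -> R x y -> R x' y -> x = x') ->
  A #<= B.
Proof.
move=> Rtot Rinj; have [->//|/set0P[a /Rtot[u _ _]]] := eqVneq A set0.
have /choice[f fP] : forall x, exists y, A x -> B y /\ R x y.
  move=> x; have [/Rtot[y By Rxy]|nAx] := pselect (A x); first by exists y.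
  by exists u.
apply/(@pcard_leP T (pointed_at u) A B)/injfunPex; exists f.
  by move=> x /fP[].
move=> x y /[!inE] Ax Ay fxy.
by apply: (Rinj x y (f x)) => //; [case: (fP x Ax)|rewrite fxy; case: (fP y Ay)].
Qed.

Lemma card_le_fun {T U : Type} (f : T -> U) (A : set T) (B : set U) :
  (forall x, A x -> B (f x)) -> (forall x y, A x -> A y -> f x = f y -> x = y) ->
  A #<= B.
Proof.
move=> fAB finj; apply: (card_le_rel (fun x y => f x = y)) => [x Ax|x x' y Ax Ax' <- /esym].
  by exists (f x) => //; apply: fAB.
exact: finj.
Qed.

Lemma card_leX {T T' U U' : Type} (A : set T) (B : set U) (A' : set T') (B' : set U') :
  A #<= B -> A' #<= B' -> A `*` A' #<= B `*` B'.
Proof.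
have [->|/set0P[u _]] := eqVneq B set0.
  by rewrite card_le0 => /eqP-> _; rewrite set0X.
have [->|/set0P[u' _]] := eqVneq B' set0.
  by rewrite card_le0 => _ /eqP->; rewrite setX0.
move=> /(card_leE u)[f fB finj] /(card_leE u')[g gB ginj].
apply: (card_le_fun (fun p => (f p.1, g p.2))) => [[x y] [/= /fB ? /gB ?]//|].
by move=> [x y] [x' y'] [/= ? ?] [/= ? ?] [/finj-> // /ginj->].
Qed.

(** Tagging with two distinct elements of [C] embeds the union into [C * C]. *)
Lemma card_leU {T U : Type} (A B : set T) (C : set U) :
  infinite_set C -> C `*` C #<= C -> A #<= C -> B #<= C -> A `|` B #<= C.
Proof.
move=> infC CC AC BC; have [u _] := infinite_setN0 infC.
have /(card_leE u)[e eC einj] := (infiniteP _).1 infC.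
move: AC BC => /(card_leE u)[f fC finj] /(card_leE u)[g gC ginj].
apply: card_le_trans CC.
apply: (card_le_rel (fun x p => (A x /\ p = (f x, e 0)) \/
                                (B x /\ p = (g x, e 1)))) => [x [Ax|Bx]|].
- by exists (f x, e 0); [split; [exact: fC|exact: eC]|left].
- by exists (g x, e 1); [split; [exact: gC|exact: eC]|right].
move=> x y p _ _ [] [Ax ->] [] [Ay []] => [/finj|_|_|/ginj]; first exact.
- by move=> /(einj 0 1 I I).
- by move=> /(einj 1 0 I I).
- exact.
Qed.

Definition partial_inj {T U : Type} (G : set (T * U)) : Prop :=
  forall p q, G p -> G q -> p.1 = q.1 <-> p.2 = q.2.

(** A maximal partial injection from [A] to [B] must exhaust [A] or [B], since
otherwise one could add a pair of unused points. *)
Lemma card_le_total {T U : Type} (A : set T) (B : set U) :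
  A #<= B \/ B #<= A.
Proof.
have [F Fchain Ftot|G [[GAB Ginj] Gmax]] :=
  @Zorn_bigcup _ [set G | G `<=` A `*` B /\ partial_inj G].
  split=> [p [G /Fchain[GAB _]]|p q [G FG Gp] [H FH Hq]]; first exact: GAB.
  have [GH|HG] := Ftot _ _ FG FH.
    by case: (Fchain _ FH) => _; apply => //; apply: GH.
  by case: (Fchain _ FG) => _; apply => //; apply: HG.
have [Gtot|/existsNP[a /not_implyP[Aa na]]] :=
    pselect (forall x, A x -> exists y, G (x, y)).
  left; apply: (card_le_rel (fun x y => G (x, y))) => [x /Gtot[y Gxy]|].
    by exists y => //; have [] := GAB _ Gxy.
  by move=> x x' y _ _ Gxy Gx'y; apply/(Ginj _ _ Gxy Gx'y).
have [Gsurj|/existsNP[b /not_implyP[Bb nb]]] :=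
    pselect (forall y, B y -> exists x, G (x, y)).
  right; apply: (card_le_rel (fun y x => G (x, y))) => [y /Gsurj[x Gxy]|].
    by exists x => //; have [] := GAB _ Gxy.
  by move=> y y' x _ _ Gxy Gxy'; apply/(Ginj _ _ Gxy Gxy').
exfalso; apply: (Gmax (G `|` [set (a, b)])).
  split; first exact: subsetUl.
  by move=> GE; apply: na; exists b; apply: GE; right.
split=> [p [/GAB//|->]//|p q [Gp|->] [Gq|->]//=].
- exact: Ginj.
- case: p Gp => x y Gp /=; split=> E; exfalso; [apply: na|apply: nb].
    by exists y; rewrite -E.
  by exists x; rewrite -E.
- case: q Gq => x y Gq /=; split=> E; exfalso; [apply: na|apply: nb].
    by exists y; rewrite E.
  by exists x; rewrite E.
Qed.

Lemma cantor (T : Type) : ~ ([set: set T] #<= [set: T]).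
Proof.
move=> /[dup] /card_leP; have [t|noT] := pselect (inhabited T); last first.
  by move=> [f] _; apply: noT; have [x _] := f (SigSub (mem_set (I : setT set0))).
case: t => t _ /(card_leE t)[g _ ginj].
pose D := [set x | exists2 A, g A = x & ~ A x].
have [DD|nD] := pselect (D (g D)); last first.
  by apply: (nD); exists D.
by have [A /(ginj _ _ I I)-> /(_ DD)] := DD.
Qed.

(** * Idempotence of infinite cardinals *)

(** Read on the diagonal, so that a graph [G] determines the set [A] on which it
is meant to be a map [A * A -> A]. *)
Definition domain {T : Type} (G : set (T * T * T)) : set T :=
  [set x | exists z, G (x, x, z)].

(** The graphs of the injections [A * A -> A], where [A = domain G]; as graphs
they are ordered by inclusion, as Zorn's lemma for unions requires. *)
Definition pairing {T : Type} (G : set (T * T * T)) : Prop :=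
  [/\ partial_inj G,
      forall x y, domain G x -> domain G y -> exists z, G (x, y, z) &
      forall x y z, G (x, y, z) -> [/\ domain G x, domain G y & domain G z]].

Lemma pairing_card {T : Type} (G : set (T * T * T)) : pairing G ->
  domain G `*` domain G #<= domain G.
Proof.
move=> [Ginj Gtot Gdom]; apply: (card_le_rel (fun p z => G (p, z))).
  move=> [x y] [/= Dx Dy]; have [z Gz] := Gtot _ _ Dx Dy.
  by exists z => //; case: (Gdom _ _ _ Gz).
by move=> p q z _ _ Gp Gq; apply/(Ginj _ _ Gp Gq).
Qed.

(** The start of the extension process: a countably infinite [A], with a pairing
transported from [nat]. *)
Lemma pairing_nat {T : Type} : infinite_set [set: T] ->
  exists G : set (T * T * T), pairing G /\ infinite_set (domain G).
Proof.
move=> infT; have [t _] := infinite_setN0 infT.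
have /(card_leE t)[e _ einj] := (infiniteP _).1 infT.
have [/(card_leE 0)[c _ cinj] _] := (card_eqPle _ _).1 card_nat2.
pose G : set (T * T * T) := [set (e p.1, e p.2, e (c p)) | p in setT].
have GD n : domain G (e n) by exists (e (c (n, n))), (n, n).
exists G; split; last first.
  by apply/infiniteP; apply: (card_le_fun e) => // x y _ _; apply: einj.
split=> [_ _ [p _ <-] [q _ <-]/=||].
- split=> [[]/(einj _ _ I I) E1 /(einj _ _ I I) E2|].
    by congr (e (c _)); case: p q E1 E2 => ? ? [? ?] /= -> ->.
  by move=> /(einj _ _ I I) /(cinj _ _ I I)->.
- move=> x y [z [p _ [<- _ _]]] [z' [q _ [<- _ _]]].
  by exists (e (c (p.1, q.1))), (p.1, q.1).
- by move=> x y z [p _ [<- <- <-]].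
Qed.

Lemma pairing_bigcup {T : Type} (F : set (set (T * T * T))) :
  F `<=` pairing -> total_on F subset -> pairing (\bigcup_(G in F) G).
Proof.
move=> Fp Ftot.
have dirF G H : F G -> F H -> exists K, [/\ F K, G `<=` K & H `<=` K].
  by move=> FG FH; have [?|?] := Ftot _ _ FG FH; [exists H|exists G]; split.
split=> [p q [G FG Gp] [H FH Hq]|x y [z [G FG Gz]] [z' [H FH Hz]]|].
- have [K [FK GK HK]] := dirF _ _ FG FH.
  by have [+ _ _] := Fp _ FK; apply; [apply: GK|apply: HK].
- have [K [FK GK HK]] := dirF _ _ FG FH.
  have [_ Ktot _] := Fp _ FK.
  have [||w Kw] := Ktot x y; first by exists z; apply: GK.
    by exists z'; apply: HK.
  by exists w, K.
- move=> x y z [G FG Gz]; have [_ _ /(_ _ _ _ Gz)[]] := Fp _ FG.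
  move=> [a Ga] [b Gb] [c Gc].
  by split; [exists a, G|exists b, G|exists c, G].
Qed.

(** If the complement of [A] contains a copy [B] of [A], the pairing extends to
[A `|` B]: all the new pairs can be sent into [B], since the square of
[A `|` B] embeds into [A], and injectivity is kept because [B] misses [A]. *)
Lemma pairing_extend {T : Type} (G : set (T * T * T)) :
  pairing G -> infinite_set (domain G) -> domain G #<= ~` domain G ->
  exists2 H, G `<` H & pairing H.
Proof.
move=> pG infA; have [Ginj Gtot Gdom] := pG; set A := domain G in infA *.
have [t At] := infinite_setN0 infA.
move=> /(card_leE t)[h hA hinj].
pose B := h @` A.
have BA x : B x -> ~ A x by move=> [y /hA + <-].
have hB : A #<= B by apply: (card_le_fun h) => // x Ax; exists x.
have BhA : B #<= A by apply: card_image_le.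
have AA : A `*` A #<= A := pairing_card _ pG.
have ABA : A `|` B #<= A.
  by apply: card_leU.
have : (A `|` B) `*` (A `|` B) #<= B.
  apply: card_le_trans hB; apply: card_le_trans AA; exact: card_leX.
move=> /(card_leE t)[k kB kinj].
pose N := [set (p, k p) | p in (A `|` B) `*` (A `|` B) `\` A `*` A].
have domE : domain (G `|` N) = A `|` B.
  apply/seteqP; split=> x.
    move=> [z [Gz|[q [[/= ABq _] _] [qE _]]]].
      by left; exists z.
    by rewrite qE in ABq.
  have [[z Gz] _|nAx ABx] := pselect (A x); first by exists z; left.
  exists (k (x, x)); right; exists (x, x) => //; split=> // -[]//.
exists (G `|` N).
  split=> [|GE]; first exact: subsetUl.
  have [z Hz] : domain (G `|` N) (h t) by rewrite domE; right; exists t.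
  by apply: (hA _ At); exists z; apply: GE.
split; rewrite ?domE.
- have GN p q : G p -> N q -> p.1 = q.1 <-> p.2 = q.2.
    case: p => [[x y] z] /Gdom[Ax Ay Az] [p ABp <-] /=; split=> E; exfalso.
      by case: ABp => _; rewrite -E; apply.
    by apply: (BA z) => //; rewrite E; apply: kB; case: ABp.
  move=> p q [Gp|Np] [Gq|Nq]; [exact: Ginj|exact: GN| |].
    by split=> /esym E; apply/esym; apply/(GN q p).
  case: Np Nq => [p' [Dp _] <-] [q' [Dq _] <-] /=.
  by split=> [->//|/kinj]; apply.
- move=> x y ABx ABy.
  have [[/= Ax Ay]|nA] := pselect ((A `*` A) (x, y)).
    by have [z Gz] := Gtot _ _ Ax Ay; exists z; left.
  by exists (k (x, y)); right; exists (x, y).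
- move=> x y z [/Gdom[? ? ?]|[p [[ABx ABy] _] [pE <-]]]; first by split; left.
  by rewrite pE in ABx ABy *; split=> //; right; apply: kB.
Qed.

(** Take a maximal pairing, with domain [A].  By [pairing_extend] the complement
of [A] contains no copy of [A], so it embeds into [A] by comparability, and then the
whole of [T], being the union of the two, is no larger than [A]. *)
Lemma card_square {T : Type} : infinite_set [set: T] ->
  [set: T * T] #<= [set: T].
Proof.
move=> infT; have [G0 [pG0 infG0]] := pairing_nat infT.
(* Maximality is taken among the extensions of [G0], which keeps [A] infinite;
   the empty chain is then bounded by [G0]. *)
have [F Fp Ftot|G [pG Gmax]] := @Zorn_bigcup _ [set G | pairing (G0 `|` G)].
  have [->|/set0P[G1 FG1]] := eqVneq F set0.
    by rewrite bigcup_set0 /= setU0.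
  rewrite /=; have -> : G0 `|` \bigcup_(G in F) G = \bigcup_(H in [set G0 `|` G | G in F]) H.
    apply/seteqP; split=> p.
      move=> [G0p|[G FG Gp]]; first by exists (G0 `|` G1); [exists G1|left].
      by exists (G0 `|` G); [exists G|right].
    by move=> [_ [G FG <-] [G0p|Gp]]; [left|right; exists G].
  apply: pairing_bigcup; first by move=> _ [G FG <-]; apply: Fp.
  move=> _ _ [G FG <-] [H FH <-].
  by have [GH|HG] := Ftot _ _ FG FH; [left|right]; apply: setUS.
set K := G0 `|` G in pG; set A := domain K.
have infA : infinite_set A.
  apply: sub_infinite_set infG0 => x [z G0z]; exists z; left; exact: G0z.
have [ACA|CAA] := card_le_total A (~` A).
  have [H KH pH] := pairing_extend _ pG infA ACA.
  have G0H : G0 `|` H = H by apply/setUidPr; case: KH => KH _ p G0p; apply: KH; left.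
  exfalso; apply: (Gmax H); rewrite /= ?G0H//.
  case: KH => KH HK; split; first by move=> p Gp; apply: KH; right.
  by move=> HG; apply: HK => p /HG Gp; right.
have TA : [set: T] #<= A by rewrite -(setUCr A); apply: card_leU (pairing_card _ pG) _ _.
rewrite -setXTT; apply: card_le_trans (card_leX _ _ _ _ TA TA) _.
exact: card_le_trans (pairing_card _ pG) (card_leT _).
Qed.

(** Send [x] to the pair of an index of a set containing it and its position in
that set. *)
Lemma card_bigcup_le {I T U : Type} (D : set I) (F : I -> set T) (B : set U) :
  (forall i, D i -> F i #<= B) -> \bigcup_(i in D) F i #<= D `*` B.
Proof.
move=> FB; have [->//|/set0P[x [i Di Fix]]] := eqVneq (\bigcup_(i in D) F i) set0.
have [u _] : B !=set0.
  apply/set0P/negP => /eqP B0; move: (FB i Di); rewrite B0 card_le0 => /eqP F0.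
  by rewrite F0 in Fix.
have /choice[f fP] : forall j, exists f : T -> U, D j ->
    set_fun (F j) B f /\ forall x y, F j x -> F j y -> f x = f y -> x = y.
  move=> j; have [/FB/(card_leE u)[f ? ?]|nD] := pselect (D j); first by exists f.
  by exists (fun=> u).
apply: (card_le_rel (fun x p => [/\ D p.1, F p.1 x & p.2 = f p.1 x])) => {x Fix}.
  move=> x [j Dj Fjx]; exists (j, f j x) => //.
  by split=> //=; apply: (fP j Dj).1.
move=> x y p _ _ [Dp Fx ->] [_ Fy]; exact: (fP _ Dp).2.
Qed.


(** * Right congruences on left cancellative semigroups *)

Section LeftCancellative.
Variables (M : monoidType).
Local Open Scope group_scope.

(** Elementary transitions.  The multiplier [s] ranges over all of [M]: this
covers [s = 1] and the elements of [S], and cancellation makes the larger range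
harmless for counting. *)
Definition step (U : set (M * M)) (x y : M) : Prop :=
  exists u v s, [/\ U (u, v), x = u * s & y = v * s].

(** [x] is reached from [a] by the word [w], read from its last letter; the
letter [(b, n)] stands for the pair of code [n], used in the direction [b]. *)
Fixpoint follows (U : set (M * M)) (c : M * M -> nat) (a : M)
    (w : seq (bool * nat)) (x : M) : Prop :=
  if w is (b, n) :: w' then
    exists u v s, [/\ U (u, v), c (u, v) = n &
      if b then follows U c a w' (u * s) /\ x = v * s
      else follows U c a w' (v * s) /\ x = u * s]
  else x = a.

(** A word determines the element that it reaches, by cancellation of the
left factor at every letter; so there are no more elements than words. *)
Lemma countable_connected (U : set (M * M)) (a : M) :
  countable U ->
  (forall u v, U (u, v) ->
    injective (fun s => u * s) /\ injective (fun s => v * s)) ->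
  countable [set x | clos_refl_sym_trans M (step U) a x].
Proof.
move=> /countable_injP[c cinj] cancel.
apply: (@card_le_trans _ _ _ [set: seq (bool * nat)]); last exact: countableP.
apply: (card_le_rel (fun x w => follows U c a w x)) => [x ax|x y w _ _].
  suff follow y z : clos_refl_sym_trans M (step U) y z ->
      (exists w, follows U c a w y) <-> (exists w, follows U c a w z).
    by have [w aw] := (follow _ _ ax).1 (ex_intro _ [::] erefl); exists w.
  elim=> {y z} [_ _ [u [v [s [Uuv -> ->]]]]|//|y z _ ->//|y z t _ -> _ ->//].
  split=> -[w aw]; [exists ((true, c (u, v)) :: w)|exists ((false, c (u, v)) :: w)];
    by exists u, v, s.
elim: w x y => [x y -> ->//|[b n] w IHw x y].
move=> [u [v [s [Uuv <- xE]]]] [u' [v' [s' [Uuv' cE yE]]]].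
have [Eu Ev] : (u', v') = (u, v) by apply: cinj; rewrite ?inE.
have [uinj vinj] := cancel _ _ Uuv.
case: b xE yE => -[ax ->] [ay ->]; rewrite Eu Ev in ay *; congr (_ * _).
  exact/uinj/IHw.
exact/vinj/IHw.
Qed.

(** An upper bound for the right congruence generated by [U]: multiplying a chain
of transitions by [s] on the right gives again a chain of transitions. *)
Lemma right_congruence_step (S : set M) (U : set (M * M)) : subsemigroup S ->
  right_congruence S
    [set p | (S `*` S) p /\ clos_refl_sym_trans M (step U) p.1 p.2].
Proof.
move=> Smul; split=> [p []//|a Sa|a b [[Sa Sb] ab]|a b c [[Sa Sb] ab] [[_ Sc] bc]|].
- by split=> //; apply: rst_refl.
- by split=> //; apply: rst_sym.
- by split=> //; apply: rst_trans bc.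
move=> a b s [[Sa Sb] /= ab] Ss; split; first by split; apply: Smul.
elim: ab => /= {a b Sa Sb} [x y [u [v [t [Uuv -> ->]]]]|x|x y _|x y z _ IH1 _ IH2].
- by apply: rst_step; exists u, v, (t * s); rewrite !mulgA.
- exact: rst_refl.
- exact: rst_sym.
- exact: rst_trans IH2.
Qed.

Lemma countable_of_fg (S : set M) : subsemigroup S ->
  (forall u, S u -> injective (fun s => u * s)) ->
  universal_right_congruence_fg S -> countable S.
Proof.
move=> Smul Scancel [U [finU US SS]].
have [->//|/set0P[a Sa]] := eqVneq S set0.
have Uc : countable [set x | clos_refl_sym_trans M (step U) a x].
  apply: countable_connected; first exact: finite_set_countable.
  by move=> u v /US[/= Su Sv]; split; apply: Scancel.
apply: sub_countable Uc; apply: subset_card_le => x Sx.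
have : universal_right_congruence S (a, x) by [].
rewrite SS => /(smallest_sub (right_congruence_step S U Smul)); case=> // -[u v] Uuv.
split; first exact: US.
by apply: rst_step; exists u, v, 1; rewrite !mulg1.
Qed.

End LeftCancellative.

(** * Semigroups of surjections *)

Section Transformations.
Variable X : Type.
Local Open Scope group_scope.

Lemma Surj_cancel (u : transf X) : Surj X u -> injective (fun s : transf X => u * s).
Proof.
move=> uS s t /funeqP st; apply/funext => y.
by have [x _ <-] := uS y I; apply: st.
Qed.

Lemma SymP (p : transf X) : Sym X p <-> bijective p.
Proof. by rewrite /Sym /= setTT_bijective. Qed.

Lemma Sym_sub_Surj : Sym X `<=` Surj X.
Proof. by move=> p []. Qed.

Lemma subsemigroup_Surj : subsemigroup (Surj X).
Proof. by move=> a b aS bS; apply: surj_comp aS bS. Qed.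

Lemma subsemigroup_Sym : subsemigroup (Sym X).
Proof. by move=> a b /SymP aS /SymP bS; apply/SymP; apply: bij_comp. Qed.

Lemma card_eq_bij {T U : Type} : T -> [set: U] #= [set: T] ->
  exists f : U -> T, bijective f.
Proof.
move=> t /(@card_set_bijP U (pointed_at t))[f].
by rewrite setTT_bijective; exists f.
Qed.

Lemma card_prod_infinite (Q : Type) :
  [set: nat] #<= [set: Q] -> [set: Q] #<= [set: X] -> [set: X * Q] #= [set: X].
Proof.
move=> NQ QX; have infX : infinite_set [set: X].
  by apply/infiniteP; apply: card_le_trans QX.
have /infiniteP infQ := NQ; have [q _] := infinite_setN0 infQ.
apply/card_eqPle; split.
  apply: card_le_trans (card_square infX).
  by rewrite -!setXTT; apply: card_leX.
by apply: (card_le_fun (fun x => (x, q))) => // x y _ _ [].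
Qed.

(** Identify [X] with [X * bool]; exchanging [(x, true)] and [(x, false)] exactly
for [x] in [A] is an involution from which [A] can be recovered. *)
Lemma Sym_uncountable : infinite_set [set: X] -> ~ countable (Sym X).
Proof.
move=> infX; have [x0 _] := infinite_setN0 infX.
have NX := (infiniteP _).1 infX.
have [f fbij] : exists f : X * bool -> X, bijective f.
  apply: card_eq_bij => //; apply/card_eqPle; split; last first.
    by apply: (card_le_fun (fun x => (x, true))) => // x y _ _ [].
  apply: card_le_trans (card_square infX).
  rewrite -!setXTT; apply: card_leX => //.
  by apply: card_le_trans NX; apply: countableP.
have [g fK gK] := fbij.
pose flip (A : set X) (p : X * bool) := (p.1, p.2 (+) `[< A p.1 >]).
have flipK A : involutive (flip A).
  by move=> [x b]; rewrite /flip /= -addbA addbb addbF.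
pose F (A : set X) : transf X := f \o flip A \o g.
have FSym A : Sym X (F A).
  apply/SymP; exists (F A) => x; rewrite /F /= fK flipK gK//.
move=> cSym; apply: (@cantor X).
apply: card_le_trans NX; apply: card_le_trans cSym.
apply: (card_le_fun F) => // A B _ _ /funeqP FAB.
apply/seteqP; suff AB x : A x <-> B x by split=> x /AB.
have := FAB (f (x, false)); rewrite /F /= fK => /(can_inj fK)[].
exact: asbool_eq_equiv.
Qed.

Lemma not_fg_of_Sym_le (S : set (transf X)) : infinite_set [set: X] ->
  S `<=` Surj X -> Sym X #<= S -> subsemigroup S ->
  ~ universal_right_congruence_fg S.
Proof.
move=> infX SS SymS Smul Sfg; apply: (Sym_uncountable infX).
apply: sub_countable SymS _.
by apply: countable_of_fg Smul _ Sfg => u /SS; apply: Surj_cancel.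
Qed.

Section Fibres.
Variable Q : Type.

Lemma DBLq_Sym (a p : transf X) : DBLq X Q a -> Sym X p -> DBLq X Q (a * p).
Proof.
move=> [aS aQ] pS; split; first by apply: subsemigroup_Surj => //; apply: Sym_sub_Surj.
have /SymP[g pK gK] := pS.
move=> x; have -> : (a * p) @^-1` [set x] = a @^-1` [set g x]; last exact: aQ.
by apply/seteqP; split=> y; rewrite /= transf_mulE; [move=> <-|move=> ->].
Qed.

Lemma Sym_DBLq (a p : transf X) : DBLq X Q a -> Sym X p -> DBLq X Q (p * a).
Proof.
move=> [aS aQ] pS; split; first by apply: subsemigroup_Surj => //; apply: Sym_sub_Surj.
have /SymP[g pK gK] := pS.
move=> x; apply: card_eq_trans (aQ x); apply/card_eqPle; split.
  by apply: (card_le_fun p) => // y z _ _ /(can_inj pK).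
apply: (card_le_fun g) => [y|y z _ _ /(can_inj gK)//].
by rewrite /= transf_mulE gK.
Qed.

(** A fibre of [a * b] is the union, over a fibre of [b], of fibres of [a]: it
contains one of them and is bounded by [Q * Q]. *)
Lemma subsemigroup_DBLq : [set: nat] #<= [set: Q] -> subsemigroup (DBLq X Q).
Proof.
move=> /infiniteP infQ a b [aS aQ] [bS bQ]; split; first exact: subsemigroup_Surj.
have [q _] := infinite_setN0 infQ.
move=> z; apply/card_eqPle; split; last first.
  have [y _ yz] := bS z I; have /card_eqPle[_ Qy] := aQ y.
  apply: card_le_trans Qy _; apply: subset_card_le => x /= xy.
  by rewrite transf_mulE xy.
apply: card_le_trans (card_square infQ).
have -> : (a * b) @^-1` [set z] = \bigcup_(y in b @^-1` [set z]) a @^-1` [set y].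
  apply/seteqP; split=> x; first by exists (a x).
  by move=> [y /= <- <-].
apply: card_le_trans (card_bigcup_le _ _ [set: Q] _) _.
  by move=> y _; have /card_eqPle[] := aQ y.
by rewrite -setXTT; apply: card_leX => //; have /card_eqPle[] := bQ z.
Qed.

Lemma DBLq_nonempty : [set: nat] #<= [set: Q] -> [set: Q] #<= [set: X] ->
  DBLq X Q !=set0.
Proof.
move=> NQ QX; have [x0 _] : [set: X] !=set0.
  by apply: infinite_setN0; apply/infiniteP; apply: card_le_trans QX.
have /infiniteP/infinite_setN0[q _] := NQ.
have [f [g fK gK]] := card_eq_bij x0 (card_prod_infinite _ NQ QX).
exists (fun x => (g x).1); split=> [x _|x]; first by exists (f (x, q)); rewrite ?fK.
apply/card_eqPle; split.
  apply: (card_le_fun (fun y => (g y).2)) => // y z /= yx zx yz.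
  apply: (can_inj gK); rewrite [g y]surjective_pairing [g z]surjective_pairing.
  by rewrite yx zx yz.
apply: (card_le_fun (fun q => f (x, q))) => [q' _|q1 q2 _ _ /(can_inj fK)[]//].
by rewrite /= fK.
Qed.

(** Left multiplication by an element of [DBLq X Q] is injective, and following
it by a permutation only relabels its fibres. *)
Lemma Sym_le_DBLq : [set: nat] #<= [set: Q] -> [set: Q] #<= [set: X] ->
  Sym X #<= DBLq X Q.
Proof.
move=> NQ QX; have [a aQ] := DBLq_nonempty NQ QX.
apply: (card_le_fun (fun p => a * p)) => [p pS|p q _ _]; first exact: DBLq_Sym.
by apply: Surj_cancel; case: aQ.
Qed.

End Fibres.
End Transformations.

Theorem theorem3p5 (X : Type) (hX : infinite_set [set: X]) :
  (forall S : set (transf X),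
      S `<=` Surj X -> subsemigroup S ->
      universal_right_congruence_fg S -> countable S) /\
  [/\ subsemigroup (Surj X) /\ ~ universal_right_congruence_fg (Surj X),
      forall Q : Type, [set: nat] #<= [set: Q] -> [set: Q] #<= [set: X] ->
        subsemigroup (DBLq X Q) /\ ~ universal_right_congruence_fg (DBLq X Q),
      subsemigroup (DBL1 X) /\ ~ universal_right_congruence_fg (DBL1 X),
      subsemigroup (Sym X `|` DBL X) /\
        ~ universal_right_congruence_fg (Sym X `|` DBL X) &
      subsemigroup (Sym X) /\ ~ universal_right_congruence_fg (Sym X)].
Proof.
have NX := (infiniteP _).1 hX.
have DBL_Surj Q : DBLq X Q `<=` Surj X by move=> a [].
have Sym1 : Sym X 1%g by apply/SymP; exists id.
have mulDBL := subsemigroup_DBLq X X NX.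
have mulSym := subsemigroup_Sym X.
have SymDBL : Sym X #<= DBL X by apply: Sym_le_DBLq.
split; first by move=> S SS Smul; apply: countable_of_fg => // u /SS; apply: Surj_cancel.
split.
- have mul := subsemigroup_Surj X; split=> //; apply: not_fg_of_Sym_le => //.
  exact/subset_card_le/Sym_sub_Surj.
- move=> Q NQ QX; have mul := subsemigroup_DBLq X Q NQ.
  by split=> //; apply: not_fg_of_Sym_le => //; apply: Sym_le_DBLq.
- have mul : subsemigroup (DBL1 X).
    move=> a b [aD|->] [bD|->]; [left; exact: mulDBL|left|left|right];
      by rewrite ?mulg1 ?mul1g.
  split=> //; apply: not_fg_of_Sym_le => //.
    by move=> a [/DBL_Surj//|->]; apply: Sym_sub_Surj.
  by apply: card_le_trans SymDBL _; apply: subset_card_le; left.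
- have mul : subsemigroup (Sym X `|` DBL X).
    move=> a b [aS|aD] [bS|bD]; [left; exact: mulSym| | |right; exact: mulDBL];
      right; [exact: Sym_DBLq|exact: DBLq_Sym].
  split=> //; apply: not_fg_of_Sym_le => //.
    by move=> a [/Sym_sub_Surj|/DBL_Surj].
  by apply: subset_card_le; left.
- by split=> //; apply: not_fg_of_Sym_le => //; apply: Sym_sub_Surj.
Qed.
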